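(* Suppose that the gross payoffs satisfy (P1)–(P5) and the cost functional satisfies (C1)–(C3). For $F\in\mathcal F$ and $x\in X$ let $A_F(x)=\mathbb E[\Pi(x,X_2,\dots,X_n)]$ with $X_2,\dots,X_n\sim dF$ i.i.d. If $G\in\mathcal F$ maximizes $v$ over $\mathcal F$, then there exists $\lambda_p\in\mathbb R$ such that $$A_G(x)-c_G(x)\le\lambda_p\quad\text{for all }x\in X,\qquad\text{and}\qquad A_G(x)-c_G(x)=\lambda_p\quad\text{for all }x\in\operatorname{supp}(dG).$$
   Context: Let $n\ge 2$ and $X=[0,1]$. Let $\mathcal F$ be the set of cdfs on $X$: right-continuous nondecreasing $F:[0,1]\to[0,1]$ with $F(1)=1$. Each $F\in\mathcal F$ induces a unique Borel probability measure $dF$ on $X$ with $dF([0,x])=F(x)$; $\operatorname{supp}(dF)$ is its support. $\mathcal F$ carries the topology of weak convergence of the measures $dF$. Each player $i$ chooses $F_i\in\mathcal F$; performances $X_i\sim dF_i$ are drawn independently. Gross payoffs are Borel functions $\pi_i:X^n\to\mathbb R$, $i=1,\dots,n$ (expected payoffs given the realized performances, after averaging over uniform tie-breaking), satisfying: (P1) there is $\bar\pi<\infty$ with $0\le\pi_i\le\bar\pi$ for all $i$; (P2) for every permutation $\sigma$ of $\{1,\dots,n\}$, every $i$ and $x$: $\pi_i(x_{\sigma(1)},\dots,x_{\sigma(n)})=\pi_{\sigma(i)}(x_1,\dots,x_n)$; (P3) $\pi_i$ is continuous at every $x\in X^n$ with $x_i\ne x_j$ for all $j\neq i$; (P4) for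 each $i$, $x_{-i}$, and $x_i'\ge x_i$: $\pi_i(x_i',x_{-i})\ge\pi_i(x_i,x_{-i})$; (P5) there is a bounded continuous symmetric function $\Pi:X^n\to\mathbb R$ with $\sum_{i=1}^n\pi_i(x)=\Pi(x)$ for all $x\in X^n$. The cost $C:\mathcal F\to\mathbb R$ satisfies: (C1) $C$ is convex and continuous with respect to weak convergence; (C2) for each $F\in\mathcal F$ there is a continuous $c_F:X\to\mathbb R$ such that for all $G\in\mathcal F$ the limit $\delta C(F;G-F)=\lim_{\varepsilon\downarrow0}\varepsilon^{-1}\left[C((1-\varepsilon)F+\varepsilon G)-C(F)\right]$ exists and equals $\int_X c_F(x)\,d(G-F)(x)$ (a choice of $c_F$, unique up to an additive constant, is fixed for each $F$); (C3) there is $\eta_1>0$ such that $c_F(1)\ge c_F(0)+\bar\pi+\eta_1$ for every $F\in\mathcal F$. Player $i$'s net payoff is $u_i(F_1,\dots,F_n)=\mathbb E[\pi_i(X_1,\dots,X_n)]-C(F_i)$. The symmetric planner's objective is $v(F)=u_1(F,\dots,F)=\frac1n\mathbb E[\Pi(X_1,\dots,X_n)]-C(F)$, where $X_1,\dots,X_n\sim dF$ are i.i.d. *)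

(* Defs.v *)
From HB Require Import structures.
From mathcomp Require Import all_boot all_order all_algebra all_fingroup.
From mathcomp Require Import all_classical all_reals all_analysis.

Set Implicit Arguments.
Unset Strict Implicit.
Unset Printing Implicit Defensive.

Import Order.TTheory GRing.Theory Num.Theory.
Import numFieldNormedType.Exports.

Local Open Scope classical_set_scope.
Local Open Scope ring_scope.

(* A cdf on X = [0,1] is stored through its unique extension to the real line
   that is 0 on ]-oo, 0[ and 1 on [1, +oo[.  An atom at 0 is allowed:
   F 0 may be positive. *)
Record cdf01 (R : realType) := Cdf01 {
  cdf01_fun :> R -> R ;
  cdf01_nd : nondecreasing cdf01_fun ;
  cdf01_rc : right_continuous cdf01_fun ;
  cdf01_lt0 : forall x, x < 0 -> cdf01_fun x = 0 ;
  cdf01_ge1 : forall x, 1 <= x -> cdf01_fun x = 1 }.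

HB.instance Definition _ (R : realType) := gen_eqMixin (cdf01 R).
HB.instance Definition _ (R : realType) := gen_choiceMixin (cdf01 R).

Section induced_measure.
Context {R : realType}.

HB.instance Definition _ (F : cdf01 R) :=
  isCumulative.Build R _ R (cdf01_fun F) (@cdf01_nd R F) (@cdf01_rc R F).

Lemma cdf01_cvgNy (F : cdf01 R) : cdf01_fun F @ -oo --> (0 : R).
Proof.
apply: cvg_near_cst; near=> x; apply/cdf01_lt0; near: x.
exact: nbhs_ninfty_lt.
Unshelve. all: by end_near. Qed.

Lemma cdf01_cvgy (F : cdf01 R) : cdf01_fun F @ +oo --> (1 : R).
Proof.
apply: cvg_near_cst; near=> x; apply/cdf01_ge1; near: x.
exact: nbhs_pinfty_ge.
Unshelve. all: by end_near. Qed.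

HB.instance Definition _ (F : cdf01 R) :=
  isCumulativeBounded.Build R 0 1 (cdf01_fun F) (cdf01_cvgNy F) (cdf01_cvgy F).

Definition dcdf (F : cdf01 R) : probability (measurableTypeR R) R :=
  lebesgue_stieltjes_measure (cdf01_fun F).

Lemma dcdfNy (F : cdf01 R) (x : R) : dcdf F `]-oo, x]%classic = (F x)%:E.
Proof.
by rewrite -(cdf_lebesgue_stieltjes_id (cdf01_fun F)) /cdf /distribution
  /pushforward preimage_id.
Qed.

Lemma dcdf_lt0 (F : cdf01 R) : dcdf F `]-oo, 0[%classic = 0%E.
Proof.
apply: measure_negligible; first exact: measurable_itv.
have : (dcdf F).-negligible (\bigcup_k `]-oo, - k.+1%:R^-1]%classic).
  apply: negligible_bigcup => k; apply/negligibleP; first exact: measurable_itv.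
  by rewrite [LHS]dcdfNy cdf01_lt0// oppr_lt0 invr_gt0.
apply: negligibleS => x /=.
rewrite in_itv/= -oppr_gt0 => x0; exists (Num.trunc (- x)^-1) => //=.
rewrite in_itv/= lerNr invf_ple ?posrE//.
by apply/ltW; exact: truncnS_gt.
Qed.

Lemma dcdf0x (F : cdf01 R) (x : R) : 0 <= x ->
  dcdf F `[0, x]%classic = (F x)%:E.
Proof.
move=> x0; rewrite -dcdfNy.
have -> : `]-oo, x]%classic = `]-oo, 0[%classic `|` `[0, x]%classic :> set R.
  apply/seteqP; split=> y /=; rewrite !in_itv/=.
    by have [y0|y0] := ltP y 0 => yx; [left|right].
  by case=> [y0|/andP[]//]; exact: le_trans (ltW y0) x0.
rewrite measureU; [|exact: measurable_itv|exact: measurable_itv|].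
  by rewrite [X in (_ = X + _)%E]dcdf_lt0 add0e.
apply/seteqP; split=> // y /= []; rewrite !in_itv/= => y0 /andP[+ _].
by rewrite leNgt y0.
Qed.

Definition supp (mu : probability (measurableTypeR R) R) : set R :=
  [set x | forall U : set R, open U -> U x -> (0 < mu U)%E].

End induced_measure.

Section mixture.
Context {R : realType}.

Definition clamp01 (t : R) : R := Num.max 0 (Num.min 1 t).

Lemma clamp01_ge0 t : 0 <= clamp01 t.
Proof. by rewrite le_max lexx. Qed.

Lemma clamp01_le1 t : clamp01 t <= 1.
Proof. by rewrite ge_max ler01 ge_min lexx. Qed.

Definition mix_fun (t : R) (F G : cdf01 R) : R -> R :=
  fun x => (1 - clamp01 t) * F x + clamp01 t * G x.

Lemma mix_nd t F G : nondecreasing (mix_fun t F G).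
Proof.
move=> x y xy; apply: lerD; apply: ler_wpM2l.
- by rewrite subr_ge0 clamp01_le1.
- exact: cdf01_nd.
- exact: clamp01_ge0.
- exact: cdf01_nd.
Qed.

Lemma mix_rc t F G : right_continuous (mix_fun t F G).
Proof. by move=> x; apply: cvgD; apply: cvgMr; exact: cdf01_rc. Qed.

Lemma mix_lt0 t F G x : x < 0 -> mix_fun t F G x = 0.
Proof. by move=> x0; rewrite /mix_fun !cdf01_lt0// !mulr0 addr0. Qed.

Lemma mix_ge1 t F G x : 1 <= x -> mix_fun t F G x = 1.
Proof. by move=> x1; rewrite /mix_fun !cdf01_ge1// !mulr1 subrK. Qed.

(* (1 - t) F + t G; only t in [0,1] is meaningful, other values of t are
   clamped to [0,1] so that the operation is total. *)
Definition mix (t : R) (F G : cdf01 R) : cdf01 R :=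
  Cdf01 (@mix_nd t F G) (@mix_rc t F G) (@mix_lt0 t F G) (@mix_ge1 t F G).

End mixture.

Section weak_topology.
Context {R : realType}.

Definition test_fun := {f : R -> R | {within `[0, 1], continuous f}}.

Definition cdf01_eval (F : cdf01 R) : {ptws test_fun -> R} :=
  fun f => \int[dcdf F]_(x in `[0, 1]) (sval f x).

(* Weak convergence of the measures dF: the coarsest topology that makes
   F |-> \int f dF continuous for every continuous f on [0,1]. *)
HB.instance Definition _ :=
  Topological.copy (cdf01 R) (initial_topology cdf01_eval).

End weak_topology.

Section product.
Context {R : realType}.
Local Notation T := (measurableTypeR R).

Definition cons_pair m (p : T * m.-tuple T) : m.+1.-tuple T :=
  [tuple of p.1 :: p.2].

Lemma measurable_cons_pair m : measurable_fun [set: _] (@cons_pair m).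
Proof. exact: measurable_cons. Qed.

HB.instance Definition _ m :=
  @isMeasurableFun.Build _ _ _ _ (@cons_pair m) (@measurable_cons_pair m).

(* The product probability of P_0, ..., P_(m-1); see prodP_box. *)
Fixpoint prodP m : ('I_m -> probability T R) -> probability (m.-tuple T) R :=
  match m with
  | 0 => fun _ => \d_ ([tuple] : 0.-tuple T)
  | m'.+1 => fun P =>
      distribution (P ord0 \x prodP (fun i => P (lift ord0 i)))%E
        (@cons_pair m')
  end.

Lemma prodP_box m (P : 'I_m -> probability T R) (A : 'I_m -> set T) :
  (forall i, measurable (A i)) ->
  prodP P [set t | forall i, A i (tnth t i)] = (\prod_(i < m) P i (A i))%E.
Proof.
elim: m P A => [|m IH] P A mA.
  by rewrite big_ord0 /= diracE mem_set// => -[].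
rewrite big_ord_recl -IH//.
rewrite /= /distribution /pushforward.
rewrite -product_measure1E//; last first.
  rewrite (_ : [set _ | _] = \big[setI/setT]_(i < m)
    ((fun t : m.-tuple T => tnth t i) @^-1` (A (lift ord0 i)))).
    apply: big_ind => //; first exact: measurableI.
    by move=> i _; rewrite -[X in measurable X]setTI; exact: measurable_tnth.
  rewrite -bigcap_seq; apply/seteqP; split=> t /= h i; first by move=> _; exact: h.
  by apply: h; rewrite /= mem_index_enum.
congr (product_measure1 _ _ _); apply/seteqP; split=> -[x t] /=.
  move=> h; split=> [|i]; [exact: (h ord0)|].
  by have := h (lift ord0 i); rewrite tnthS.
move=> [h1 h2] i; case: (unliftP ord0 i) => [j|] ->; first by rewrite tnthS.
exact: h1.
Qed.

End product.

Section contest.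
Context {R : realType}.

Definition cube n : set 'rV[R]_n := [set x | forall i, x 0 i \in `[0, 1]].

(* Expectation of f (X_1, ..., X_n) for independent X_i ~ dF_i, all supported
   on [0,1]. *)
Definition expect n (F : 'I_n -> cdf01 R) (f : 'rV[R]_n -> R) : R :=
  \int[prodP (fun i => dcdf (F i))]_(t in
      [set t | cube (\row_i tnth t i)]) f (\row_i tnth t i).

Definition borel_rV n := g_sigma_algebraType (@open 'rV[R]_n).

Record gross_payoffs n (pibar : R) (pay : 'I_n -> 'rV[R]_n -> R)
    (Pi : 'rV[R]_n -> R) : Prop := {
  pay_borel : forall i, measurable_fun (@cube n : set (borel_rV n)) (pay i) ;
  pay_bounded : forall i x, cube x -> 0 <= pay i x <= pibar ;
  (* col_perm s x = (x_{s(1)}, ..., x_{s(n)}) *)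
  pay_symmetric : forall (s : 'S_n) i x, cube x ->
    pay i (col_perm s x) = pay (s i) x ;
  pay_continuous : forall i x, cube x ->
    (forall j, j != i -> x 0 i != x 0 j) ->
    pay i @ within (@cube n) (nbhs x) --> pay i x ;
  pay_monotone : forall i x x', cube x -> cube x' ->
    (forall j, j != i -> x' 0 j = x 0 j) -> x 0 i <= x' 0 i ->
    pay i x <= pay i x' ;
  total_bounded : exists M, forall x, cube x -> `|Pi x| <= M ;
  total_continuous : {within @cube n, continuous Pi} ;
  total_symmetric : forall (s : 'S_n) x, cube x -> Pi (col_perm s x) = Pi x ;
  total_sum : forall x, cube x -> \sum_(i < n) pay i x = Pi x }.

(* c F is the chosen representative of the derivative of C at F. *)
Record cost_functional (pibar : R) (C : cdf01 R -> R)
    (c : cdf01 R -> R -> R) : Prop := {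
  cost_convex : forall F G t, 0 <= t <= 1 ->
    C (mix t F G) <= (1 - t) * C F + t * C G ;
  cost_continuous : continuous C ;
  cost_grad_continuous : forall F, {within `[0, 1], continuous (c F)} ;
  cost_gateaux : forall F G,
    e^-1 * (C (mix e F G) - C F) @[e --> (0 : R)^'+] -->
      \int[dcdf G]_(x in `[0, 1]) (c F x) -
      \int[dcdf F]_(x in `[0, 1]) (c F x) ;
  cost_steep : exists2 eta : R, 0 < eta &
    forall F, c F 0 + pibar + eta <= c F 1 }.

Definition net_payoff n (pay : 'I_n -> 'rV[R]_n -> R) (C : cdf01 R -> R)
    (i : 'I_n) (F : 'I_n -> cdf01 R) : R :=
  expect F (pay i) - C (F i).

Definition planner n (pay : 'I_n.+1 -> 'rV[R]_n.+1 -> R) (C : cdf01 R -> R)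
    (F : cdf01 R) : R :=
  net_payoff pay C ord0 (fun=> F).

(* E[Pi (x, X_2, ..., X_n)] with X_2, ..., X_n i.i.d. ~ dF, where the number of
   players is n.+1 here. *)
Definition total_given n (Pi : 'rV[R]_n.+1 -> R) (F : cdf01 R) (x : R) : R :=
  expect (fun=> F) (fun y : 'rV[R]_n => Pi (row_mx (x%:M : 'rV_1) y)).

End contest.

(* Main.v *)
Require Import Defs.
From HB Require Import structures.
From mathcomp Require Import all_boot all_order all_algebra all_fingroup.
From mathcomp Require Import all_classical all_reals all_analysis.
From mathcomp Require Import measurable_realfun ring lra.
Set Implicit Arguments.
Unset Strict Implicit.
Unset Printing Implicit Defensive.
Import Order.TTheory GRing.Theory Num.Theory.
Import numFieldNormedType.Exports.
Local Open Scope classical_set_scope.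
Local Open Scope ring_scope.

(* The map e |-> E[pay_0] under the mixture (1 - e) G + e H is a polynomial
   whose linear coefficient is the sum over the players i of the effect on
   player 0's payoff of letting X_i follow H instead of G.  By symmetry this is
   the effect on player i's payoff of letting X_0 follow H, so the sum over i is
   int A_G dH - int A_G dG, because the payoffs add up to Pi.  With the Gateaux
   derivative of C, optimality of G gives
   int (A_G - c_G) dH <= int (A_G - c_G) dG =: lambda for every H.  Point masses
   H yield the inequality, and lambda - (A_G - c_G) is then a nonnegative
   continuous function with zero dG-integral, so it vanishes on the support. *)

(** * Integrals of bounded measurable functions *)

Section bounded_measurable.
Context {R : realType}.

(** All measures below are probabilities, so this class is integrable. It is also stable under
    sections and partial integration, which makes Fubini available without side conditions. *)
Definition bounded_meas d (T : measurableType d) (g : T -> R) : Prop :=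
  measurable_fun [set: T] g /\ exists M, forall x, `|g x| <= M.

Lemma bounded_meas_comp d d' (S : measurableType d) (T : measurableType d')
    (h : S -> T) (g : T -> R) :
  measurable_fun [set: S] h -> bounded_meas g -> bounded_meas (g \o h).
Proof.
by move=> mh [mg [M gM]]; split; [exact: measurableT_comp|exists M => x; exact: gM].
Qed.

Lemma bounded_measZ d (T : measurableType d) (k : R) (g : T -> R) :
  bounded_meas g -> bounded_meas (fun x => k * g x).
Proof.
move=> [mg [M gM]]; split; first exact: measurable_funM.
by exists (`|k| * M) => x; rewrite normrM ler_wpM2l.
Qed.

Lemma bounded_meas_integrable d (T : measurableType d)
    (P : probability T R) (g : T -> R) :
  bounded_meas g -> P.-integrable [set: T] (EFin \o g).
Proof.
move=> [mg [M gM]]; apply: measurable_bounded_integrable => //.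
  by rewrite (le_lt_trans (probability_le1 P _))// ltry.
exists M; split; first exact: num_real.
by move=> N MN x _ /=; exact: (le_trans (gM x) (ltW MN)).
Qed.

Lemma RintegralEFin d (T : measurableType d) (P : probability T R) (g : T -> R) :
  bounded_meas g -> (\int[P]_x g x)%:E = (\int[P]_x (g x)%:E)%E.
Proof.
move=> bg; rewrite /Rintegral fineK//.
exact: (integrable_fin_num measurableT (bounded_meas_integrable P bg)).
Qed.

Lemma Rintegral_norm_le d (T : measurableType d) (P : probability T R)
    (g : T -> R) M : bounded_meas g -> (forall x, `|g x| <= M) ->
  `|\int[P]_x g x| <= M.
Proof.
move=> bg gM; have ig := bounded_meas_integrable P bg.
apply: (le_trans (le_normr_Rintegral measurableT ig)).
have -> : M = \int[P]_(x in setT) M.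
  by rewrite Rintegral_cst// [X in fine X]probability_setT mulr1.
apply: le_Rintegral => //.
- by have := integrable_norm ig; apply: eq_integrable => // x _.
- exact: finite_measure_integrable_cst.
Qed.

Lemma bounded_meas_cst d (T : measurableType d) (k : R) :
  bounded_meas (fun _ : T => k).
Proof. by split; [exact: measurable_cst|exists `|k|]. Qed.

Lemma bounded_measD d (T : measurableType d) (f g : T -> R) :
  bounded_meas f -> bounded_meas g -> bounded_meas (fun x => f x + g x).
Proof.
move=> [mf [M fM]] [mg [N gN]]; split; first exact: measurable_funD.
by exists (M + N) => x; rewrite (le_trans (ler_normD _ _))// lerD.
Qed.

Lemma bounded_meas_sum d (T : measurableType d) (I : Type) (r : seq I)
    (f : I -> T -> R) :
  (forall i, bounded_meas (f i)) -> bounded_meas (fun x => \sum_(i <- r) f i x).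
Proof.
move=> bf; elim: r => [|i r IH].
  by under eq_fun do rewrite big_nil; exact: bounded_meas_cst.
by under eq_fun do rewrite big_cons; exact: bounded_measD.
Qed.

Lemma Rintegral_addr d (T : measurableType d) (P : probability T R)
    (f : T -> R) k : bounded_meas f ->
  \int[P]_x (f x + k) = \int[P]_x f x + k.
Proof.
move=> bf; rewrite RintegralD//; try exact: bounded_meas_integrable.
  by rewrite Rintegral_cst// [X in fine X]probability_setT mulr1.
exact/bounded_meas_integrable/bounded_meas_cst.
Qed.

Lemma Rintegral_sum_bounded d (T : measurableType d) (P : probability T R)
    (I : Type) (r : seq I) (f : I -> T -> R) :
  (forall i, bounded_meas (f i)) ->
  \int[P]_x (\sum_(i <- r) f i x) = \sum_(i <- r) \int[P]_x f i x.
Proof.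
move=> bf; rewrite /Rintegral; under eq_integral do rewrite -sumEFin.
rewrite integral_sum//; last by move=> i; exact: bounded_meas_integrable.
by under eq_bigr do rewrite -RintegralEFin//; rewrite sumEFin.
Qed.

Lemma Rintegral_pushforward_bounded d d' (S : measurableType d)
    (T : measurableType d') (P : probability S R) (X : {mfun S >-> T})
    (g : T -> R) : bounded_meas g ->
  \int[distribution P X]_y g y = \int[P]_x g (X x).
Proof.
move=> bg; rewrite /Rintegral integral_distribution//.
  by apply/measurable_EFinP; case: bg => [mg _].
by apply: bounded_meas_integrable; exact: bounded_meas_comp.
Qed.

Section fubini.
Context d1 d2 (S : measurableType d1) (T : measurableType d2).
Variable g : S * T -> R.
Hypothesis bg : bounded_meas g.

Lemma bounded_meas_section1 x : bounded_meas (fun y => g (x, y)).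
Proof. exact: (@bounded_meas_comp _ _ _ _ (pair x) g). Qed.

Lemma bounded_meas_section2 y : bounded_meas (fun x => g (x, y)).
Proof. exact: (@bounded_meas_comp _ _ _ _ (fun x => (x, y)) g). Qed.

Let ig (P : probability S R) (Q : probability T R) :
  (P \x Q)%E.-integrable setT (EFin \o g).
Proof. exact: bounded_meas_integrable. Qed.

Lemma bounded_meas_Rintegral2 (P : probability S R) :
  bounded_meas (fun y => \int[P]_x g (x, y)).
Proof.
split; last first.
  case: bg => _ [M gM]; exists M => y.
  by apply: Rintegral_norm_le => //; exact: bounded_meas_section2.
apply/measurable_EFinP.
under [X in measurable_fun _ X]eq_fun.
  move=> x /=; rewrite RintegralEFin; last exact: bounded_meas_section2.
  over.
(* The Fubini lemma asks for a measure on the second factor. The inner integral does not depend on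
   it, so a Dirac mass serves. *)
exact: (measurable_fubini_G (ig P \d_point)).
Qed.

Lemma Rintegral_prod1 (P : probability S R) (Q : probability T R) :
  \int[(P \x Q)%E]_z g z = \int[P]_x \int[Q]_y g (x, y).
Proof.
rewrite /Rintegral -(integral12_prod_meas1 (ig P Q)); congr fine.
by apply: eq_integral => x _; rewrite [RHS]RintegralEFin//; exact: bounded_meas_section1.
Qed.

Lemma Rintegral_prod2 (P : probability S R) (Q : probability T R) :
  \int[(P \x Q)%E]_z g z = \int[Q]_y \int[P]_x g (x, y).
Proof.
rewrite /Rintegral -(integral21_prod_meas1 (ig P Q)); congr fine.
by apply: eq_integral => x _; rewrite [RHS]RintegralEFin//; exact: bounded_meas_section2.
Qed.

End fubini.

End bounded_measurable.

(** * Finite product probabilities *)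

Section product_probability.
Context {R : realType}.
Local Notation T := (measurableTypeR R).

Local Arguments prodP : simpl never.

Lemma bounded_meas_cons_pair m (g : m.+1.-tuple T -> R) :
  bounded_meas g -> bounded_meas (fun z : T * m.-tuple T => g (cons_pair z)).
Proof. exact: (@bounded_meas_comp _ _ _ _ _ (@cons_pair R m)). Qed.

(** Integrating coordinate 0 last leaves a conditional expectation given that coordinate, the form
    of [total_given]. *)
Lemma Rintegral_prodP1 m (P : 'I_m.+1 -> probability T R)
    (g : m.+1.-tuple T -> R) : bounded_meas g ->
  \int[prodP P]_t g t =
  \int[P ord0]_x \int[prodP (fun i => P (lift ord0 i))]_t g (cons_pair (x, t)).
Proof.
move=> bg; rewrite [LHS]Rintegral_pushforward_bounded// Rintegral_prod1//.
exact: bounded_meas_cons_pair.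
Qed.

(** Integrating coordinate 0 first leaves a bounded measurable function of the other [m]
    coordinates, to which an induction on their number applies. *)
Lemma Rintegral_prodP2 m (P : 'I_m.+1 -> probability T R)
    (g : m.+1.-tuple T -> R) : bounded_meas g ->
  \int[prodP P]_t g t =
  \int[prodP (fun i => P (lift ord0 i))]_t \int[P ord0]_x g (cons_pair (x, t)).
Proof.
move=> bg; rewrite [LHS]Rintegral_pushforward_bounded// Rintegral_prod2//.
exact: bounded_meas_cons_pair.
Qed.

Definition box m (A : 'I_m -> set T) : set (m.-tuple T) :=
  [set t | forall i, A i (tnth t i)].

Lemma measurable_box m (A : 'I_m -> set T) :
  (forall i, measurable (A i)) -> measurable (box A).
Proof.
move=> mA; rewrite (_ : box A = \big[setI/setT]_(i < m)
  ((fun t : m.-tuple T => tnth t i) @^-1` (A i))).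
  apply: big_ind => //; first exact: measurableI.
  by move=> i _; rewrite -[X in measurable X]setTI; exact: measurable_tnth.
rewrite -bigcap_seq; apply/seteqP; split=> t /= h i; first by move=> _; exact: h.
by apply: h; rewrite /= mem_index_enum.
Qed.

(** Boxes are stable under intersection, include the whole space and generate the product
    sigma-algebra, so they determine a probability. *)
Lemma eq_measure_box m (Q1 Q2 : probability (m.-tuple T) R) :
  (forall A : 'I_m -> set T, (forall i, measurable (A i)) ->
    Q1 (box A) = Q2 (box A)) ->
  forall B, measurable B -> Q1 B = Q2 B.
Proof.
move=> Q12 B mB; apply: (measure_unique
  [set box A | A in [set A : 'I_m -> set T | forall i, measurable (A i)]]
  (fun=> setT)) => //.
- apply/seteqP; split; last first.
    apply: smallest_sub; first exact: sigma_algebra_measurable.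
    by move=> _ [A mA <-]; exact: measurable_box.
  apply: smallest_sub; first exact: smallest_sigma_algebra.
  move=> A; rewrite -bigcup_seq => -[/= i _ [C mC <-]].
  apply: sub_sigma_algebra.
  (* A generator constrains the single coordinate [i]; it is the box with full sides elsewhere. *)
  exists (fun j => if j == i then C else setT).
    by move=> j; case: ifP.
  apply/seteqP; split=> t /=; first by move/(_ i); rewrite eqxx.
  by move=> [_ Ct] j; case: ifP => // /eqP ->.
- move=> _ _ [A mA <-] [C mC <-]; exists (fun i => A i `&` C i).
    by move=> i; exact: measurableI.
  apply/seteqP; split=> t /=; first by move=> ACt; split=> i; case: (ACt i).
  by move=> [At Ct] i; split; [exact: At|exact: Ct].
- by move=> _; exists (fun=> setT) => //; apply/seteqP; split.
- by rewrite bigcup_const//; exists 0%N.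
- by move=> _ [A mA <-]; exact: Q12.
- by move=> _; rewrite (le_lt_trans (probability_le1 Q1 _))// ltry.
Qed.

Definition perm_tuple m (s : 'S_m) (t : m.-tuple T) : m.-tuple T :=
  [tuple tnth t (s i) | i < m].

Lemma measurable_perm_tuple m (s : 'S_m) :
  measurable_fun [set: _] (perm_tuple s).
Proof.
apply/measurable_fun_tnthP => i.
rewrite (_ : _ \o _ = (fun t : m.-tuple T => tnth t (s i))).
  exact: measurable_tnth.
by apply/funext => t /=; rewrite tnth_mktuple.
Qed.

HB.instance Definition _ m (s : 'S_m) :=
  @isMeasurableFun.Build _ _ _ _ (perm_tuple s) (@measurable_perm_tuple m s).

(** Both sides integrate [g] against a law on tuples. On boxes the two laws give the same product of
    masses, reindexed by [s]. *)
Lemma Rintegral_prodP_perm m (P : 'I_m -> probability T R) (s : 'S_m)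
    (g : m.-tuple T -> R) : bounded_meas g ->
  \int[prodP (P \o s)]_t g t = \int[prodP P]_t g (perm_tuple s t).
Proof.
move=> bg; rewrite -Rintegral_pushforward_bounded// /Rintegral.
congr fine; apply: eq_measure_integral => B mB _.
apply: eq_measure_box mB => A mA.
rewrite [LHS](prodP_box (P \o s) mA).
transitivity (prodP P (box (fun i => A ((s^-1)%g i)))).
  rewrite [RHS]prodP_box//.
  rewrite [RHS](reindex_inj (@perm_inj _ s))/=.
  by apply: eq_bigr => i _; rewrite permK.
congr (prodP P _); apply/seteqP; split=> t /= At i.
  by have := At (s i); rewrite permK tnth_mktuple.
by have := At ((s^-1)%g i); rewrite tnth_mktuple permKV.
Qed.

(** The integral is affine in the law of each coordinate, so substituting the mixture in one
    coordinate after another raises the degree in [e] by at most one each time. The linear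
    coefficient collects the effects of changing one coordinate at a time. *)
Lemma prodP_mixture_poly m (P : R -> probability T R) (P0 P1 : probability T R) :
  (forall e (h : T -> R), 0 <= e <= 1 -> bounded_meas h ->
    \int[P e]_x h x = (1 - e) * \int[P0]_x h x + e * \int[P1]_x h x) ->
  forall g : m.-tuple T -> R, bounded_meas g ->
  exists p : {poly R},
    [/\ p`_0 = \int[prodP (fun=> P0)]_t g t,
     p`_1 = \sum_(i < m) (\int[prodP (fun j => if j == i then P1 else P0)]_t g t
       - \int[prodP (fun=> P0)]_t g t) &
     forall e, 0 <= e <= 1 -> p.[e] = \int[prodP (fun=> P e)]_t g t].
Proof.
move=> Pmix; elim: m => [|m IH] g bg.
  exists (\int[prodP (fun=> P0)]_t g t)%:P; split.
  - by rewrite coefC.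
  - by rewrite coefC/= big_ord0.
  - by move=> e _; rewrite hornerC.
have bg' := bounded_meas_cons_pair bg.
have bgQ (Q : probability T R) :
    bounded_meas (fun t : m.-tuple T => \int[Q]_x g (cons_pair (x, t))).
  exact: (bounded_meas_Rintegral2 bg' Q).
have [p [p0 p1 pE]] := IH _ (bgQ P0).
have [q [q0 q1 qE]] := IH _ (bgQ P1).
exists (p + 'X * (q - p)); split.
- by rewrite coefD coefXM/= addr0 p0 Rintegral_prodP2.
- rewrite coefD coefXM/= coefB p0 q0 p1 big_ord_recl/= addrC; congr (_ + _).
    by rewrite !Rintegral_prodP2.
  apply: eq_bigr => i _; rewrite !Rintegral_prodP2//; congr (_ - _).
- move=> e e01; rewrite hornerD hornerM hornerX hornerD hornerN pE// qE//.
  rewrite Rintegral_prodP2//=.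
  under [RHS]eq_Rintegral => t _.
    rewrite (Pmix e)//; last exact: (bounded_meas_section2 bg' t).
    over.
  set Q := prodP _.
  rewrite RintegralD//.
  + rewrite !RintegralZl//; last 2 first.
      exact/bounded_meas_integrable/bgQ.
      exact/bounded_meas_integrable/bgQ.
    ring.
  + exact/bounded_meas_integrable/bounded_measZ/bgQ.
  + exact/bounded_meas_integrable/bounded_measZ/bgQ.
Qed.

End product_probability.

(** * Mixtures and point masses *)

Section cdf_laws.
Context {R : realType}.
Local Notation T := (measurableTypeR R).

(** A Lebesgue-Stieltjes measure is determined by its values on intervals ]a, b], which are
    differences of half-lines of finite mass. *)
Lemma dcdf_unique (F : cdf01 R) (mu : {measure set T -> \bar R}) :
  (forall x, mu `]-oo, x]%classic = (F x)%:E) ->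
  forall A, measurable A -> dcdf F A = mu A.
Proof.
move=> muF A mA.
apply: lebesgue_stieltjes_measure_unique mA => _ [[a b]]/= _ <-.
have [ab|ba] := leP a b; last first.
  by rewrite set_itv_ge ?measure0// bnd_simp -leNgt ltW.
have muab (nu : {measure set T -> \bar R}) :
    (forall x, nu `]-oo, x]%classic = (F x)%:E) ->
    nu `]a, b]%classic = (F b - F a)%:E.
  move=> nuF; have -> : `]a, b]%classic = `]-oo, b] `\` `]-oo, a] :> set R.
    by rewrite -[RHS]setCK setCD setCitvl setUC -[LHS]setCK setCitv.
  have nub : (nu `]-oo, b]%classic < +oo)%E by rewrite nuF ltry.
  rewrite measureD// setIidr; last exact: subset_itvl.
  by rewrite EFinB; congr (_ - _)%E; exact: nuF.
by rewrite (muab mu)//; exact: (muab (dcdf F) (dcdfNy F)).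
Qed.

(** The law of the mixed cdf is the mixture of the laws, since the two agree on half-lines.
    Additivity of the integral in the measure is applied to nonnegative functions first. *)
Lemma Rintegral_mix (F G : cdf01 R) e (h : T -> R) : 0 <= e <= 1 ->
  bounded_meas h ->
  \int[dcdf (mix e F G)]_x h x =
    (1 - e) * \int[dcdf F]_x h x + e * \int[dcdf G]_x h x.
Proof.
move=> /andP[e0 e1] bh.
have e1' : 0 <= 1 - e by rewrite subr_ge0.
have law := @dcdf_unique (mix e F G)
  (measure_add (mscale (NngNum e1') (dcdf F)) (mscale (NngNum e0) (dcdf G))).
have {}law A : measurable A -> dcdf (mix e F G) A =
    measure_add (mscale (NngNum e1') (dcdf F)) (mscale (NngNum e0) (dcdf G)) A.
  apply: law => x; rewrite /measure_add/= /msum !big_ord_recl big_ord0/= /mscale/=.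
  rewrite !dcdfNy adde0 -!EFinM -EFinD /mix_fun/= /clamp01.
  by rewrite (min_idPr e1) (max_idPr e0).
have nneg (k : T -> R) : bounded_meas k -> (forall x, 0 <= k x) ->
  \int[dcdf (mix e F G)]_x k x =
    (1 - e) * \int[dcdf F]_x k x + e * \int[dcdf G]_x k x.
  move=> bk k0; rewrite {1}/Rintegral.
  have mk : measurable_fun setT (EFin \o k).
    by case: bk => mk _; exact/measurable_EFinP.
  rewrite (eq_measure_integral (measure_add (mscale (NngNum e1') (dcdf F))
    (mscale (NngNum e0) (dcdf G)))); last by move=> A mA _; exact: law.
  rewrite ge0_integral_measure_add//; last by move=> x _; rewrite lee_fin.
  rewrite !ge0_integral_mscale//; [|by move=> x _; rewrite lee_fin..].
  by rewrite -(RintegralEFin (dcdf F) bk) -(RintegralEFin (dcdf G) bk).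
have [mh [M hM]] := bh.
have hM0 x : 0 <= h x + M.
  by rewrite -lerBlDr sub0r; have := hM x; rewrite ler_norml => /andP[].
(* Adding the bound [M] makes [h] nonnegative; as the weights sum to 1, [M] cancels. *)
have shift (a b c : R) : a + M = (1 - e) * (b + M) + e * (c + M) ->
  a = (1 - e) * b + e * c by lra.
apply: shift; have := nneg _ (bounded_measD bh (bounded_meas_cst _ M)) hM0.
rewrite (Rintegral_addr (dcdf (mix e F G)) M bh) (Rintegral_addr (dcdf F) M bh).
by rewrite (Rintegral_addr (dcdf G) M bh).
Qed.

Section point_mass.
Variables (x : R) (x0 : 0 <= x) (x1 : x <= 1).

Let point_fun (y : R) : R := (x <= y)%R%:R.

Let point_nd : nondecreasing point_fun.
Proof.
move=> y z yz; rewrite /point_fun; have [xy|_] := leP x y => //=.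
by rewrite (le_trans xy yz).
Qed.

Let point_rc : right_continuous point_fun.
Proof.
move=> a; apply: cvg_near_cst; rewrite /point_fun.
have [xa|ax] := leP x a.
  near=> y.
  have ay : a <= y by near: y; exact: nbhs_right_ge.
  by rewrite (le_trans xa ay).
near=> y.
have yx : y < x by near: y; exact: nbhs_right_lt.
by rewrite leNgt yx.
Unshelve. all: by end_near. Qed.

Let point_lt0 y : y < 0 -> point_fun y = 0.
Proof. by move=> y0; rewrite /point_fun leNgt (lt_le_trans y0 x0). Qed.

Let point_ge1 y : 1 <= y -> point_fun y = 1.
Proof. by move=> y1; rewrite /point_fun (le_trans x1 y1). Qed.

Definition point_cdf : cdf01 R := Cdf01 point_nd point_rc point_lt0 point_ge1.

Lemma Rintegral_point_cdf (D : set T) (h : T -> R) : measurable D -> D x ->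
  measurable_fun D h -> \int[dcdf point_cdf]_(y in D) h y = h x.
Proof.
move=> mD Dx mh; rewrite /Rintegral.
rewrite (eq_measure_integral (\d_(x : T))); last first.
  move=> A mA _; apply: dcdf_unique => // y /=.
  by rewrite diracE /point_fun mem_setE in_itv.
rewrite integral_dirac//=; last exact/measurable_EFinP.
by rewrite indicE mem_set// mul1r.
Qed.

End point_mass.

End cdf_laws.

(** * Borel functions of the coordinates *)

Section borel_coordinates.
Context {R : realType}.
Local Notation T := (measurableTypeR R).

(** Passes from the product sigma-algebra, where [prodP] lives, to the Borel sigma-algebra, where
    payoffs are measurable. *)
Definition row_tuple n (t : n.-tuple T) : borel_rV n := \row_i tnth t i.

(** The preimage of an open set is a countable union of boxes with rational centres and radii
    1/(k+1). *)
Lemma measurable_row_tuple n : measurable_fun [set: n.-tuple T] (@row_tuple n).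
Proof.
apply: (@measurability _ _ (n.-tuple T) (borel_rV n) setT (@row_tuple n)
  (@open 'rV[R]_n)) => // _ [U oU <-]; rewrite setTI.
pose I : Type := ({ffun 'I_n -> rat} * nat)%type.
pose bx (a : I) := box (fun i => ball (ratr (a.1 i) : R) (a.2.+1%:R^-1) : set T).
rewrite (_ : _ @^-1` _ = \bigcup_(a : I)
    (* Boxes that leave the preimage are replaced by the empty set, so that the union runs over the
       whole countable type [I]. *)
    (if `[< bx a `<=` @row_tuple n @^-1` U >] then bx a else set0)).
  apply: countable_bigcupT_measurable => [|a].
    exact: (@countableP ({ffun 'I_n -> rat} * nat)%type).
  case: ifP => // _.
  by apply: measurable_box => i; exact: measurable_ball.
apply/seteqP; split=> [t Ut|t [a _]]; last first.
  by case: ifPn => // /asboolP; exact.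
have /nbhs_ballP[e /= e0 teU] := open_nbhs_nbhs (conj oU Ut).
(* With a radius below [e / 2], two points of a box, compared through its centre, are less than [e]
   apart in each coordinate. *)
have [k ke] : exists k : nat, k.+1%:R^-1 < e / 2.
  have e2 : 0 < e / 2 by rewrite divr_gt0.
  exists (Num.truncn (e / 2)^-1).
  by rewrite invf_plt ?posrE// truncnS_gt.
have k0 : 0 < k.+1%:R^-1 :> R by rewrite invr_gt0.
have /choice[q qt] : forall i, exists q : rat,
    ball (ratr q : R) (k.+1%:R^-1) (tnth t i).
  move=> i; have /rat_in_itvoo[q] : tnth t i - k.+1%:R^-1 < tnth t i + k.+1%:R^-1.
    by rewrite ltrBlDr -addrA ltrDl addr_gt0.
  rewrite in_itv/= => /andP[q1 q2]; exists q.
  rewrite /ball/= ltr_norml; apply/andP; split.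
    by rewrite ltrBrDl.
  by rewrite ltrBlDl.
exists ([ffun i => q i], k) => //.
have tq : bx ([ffun i => q i], k) t by move=> i /=; rewrite ffunE; exact: qt.
rewrite ifT//; apply/asboolP => s sq; apply: teU; split=> // i j.
rewrite ord1 !mxE (splitr e); apply: (@ball_triangle _ _ (ratr (q j) : R)).
  by apply/ball_sym; apply: le_ball (ltW ke) _ _; exact: qt.
by apply: le_ball (ltW ke) _ _; have := sq j; rewrite /= ffunE.
Qed.

Lemma measurable_cube n : measurable (@cube R n : set (borel_rV n)).
Proof.
rewrite -[X in measurable X]setCK; apply: measurableC.
apply: sub_sigma_algebra; apply: closed_openC.
rewrite (_ : @cube R n = \bigcap_(i in [set: 'I_n])
    ((fun x : 'rV[R]_n => x 0 i) @^-1` `[0, 1]%classic)).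
  apply: closed_bigI => i _; apply: preimage_closed; last exact: itv_closed.
  by move=> x _; exact: coord_continuous.
by apply/seteqP; split=> x /= cx i; [move=> _; exact: cx|exact: (cx i I)].
Qed.

Lemma bounded_meas_cube n (f : 'rV[R]_n -> R) M :
  measurable_fun (@cube R n : set (borel_rV n)) f ->
  (forall x, cube x -> `|f x| <= M) ->
  bounded_meas ((f \_ (@cube R n)) \o @row_tuple n).
Proof.
move=> mf fM; apply: (@bounded_meas_comp _ _ _ (n.-tuple T) (borel_rV n)).
  exact: measurable_row_tuple.
split.
  exact: (measurable_restrictT (f : borel_rV n -> R) (@measurable_cube n)).1.
(* The absolute value also bounds the value 0 taken off the cube, whatever the sign of [M]. *)
exists `|M| => x; rewrite patchE; case: ifPn; last by rewrite normr0.
by rewrite inE => /fM /le_trans; apply; exact: ler_norm.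
Qed.

(** Moves the restriction to the cube into the integrand, extended by 0, so that the results on
    bounded functions over the full space apply. *)
Lemma expectE n (F : 'I_n -> cdf01 R) (f : 'rV[R]_n -> R) :
  expect F f = \int[prodP (fun i => dcdf (F i))]_t
    ((f \_ (@cube R n)) \o @row_tuple n) t.
Proof. by rewrite /expect Rintegral_mkcond; congr Rintegral. Qed.

End borel_coordinates.

(** * Supports *)

Section support.
Context {R : realType}.
Local Notation T := (measurableTypeR R).

Lemma dcdf01 (F : cdf01 R) : dcdf F `[0, 1]%classic = 1%E.
Proof. by rewrite dcdf0x// cdf01_ge1. Qed.

Lemma dcdf_setI01 (F : cdf01 R) (U : set T) : measurable U ->
  dcdf F U = dcdf F (U `&` `[0, 1]%classic).
Proof.
move=> mU; have m01 : measurable (`[0, 1]%classic : set T).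
  exact: measurable_itv.
rewrite -{1}(setIT U) -(setUv `[0, 1]%classic) setIUr measureU//; last 3 first.
- exact: measurableI.
- by apply: measurableI => //; exact: measurableC.
- by rewrite setIACA setICr setI0.
rewrite [X in (_ + X)%E](_ : _ = 0%E) ?adde0//.
have mC : measurable (~` `[0, 1]%classic : set T) by exact: measurableC.
have muC : dcdf F (~` `[0, 1]%classic) = 0%E.
  by rewrite probability_setC// [X in (_ - X)%E]dcdf01 subee.
by apply: (subset_measure0 _ mC _ muC) => //; exact: measurableI.
Qed.

Lemma supp_dcdf01 (F : cdf01 R) (x : R) : supp (dcdf F) x -> x \in `[0, 1].
Proof.
move=> Fx; apply/negPn/negP => x01.
have oC : open (~` `[0, 1]%classic : set R).
  by apply: closed_openC; exact: itv_closed.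
have := Fx _ oC (negP x01).
rewrite dcdf_setI01; last exact: open_measurable.
by rewrite setICl measure0 ltxx.
Qed.

Lemma integrable_continuous01 (F : cdf01 R) (f : R -> R) :
  {within `[0, 1]%classic, continuous f} ->
  (dcdf F).-integrable `[0, 1]%classic (EFin \o f).
Proof.
move=> cf; apply: measurable_bounded_integrable => //.
- by rewrite [X in (X < _)%E]dcdf01 ltry.
- by apply: subspace_continuous_measurable_fun cf; exact: measurable_itv.
- have /compact_bounded := continuous_compact cf (@segment_compact R 0 1).
  move=> [M [Mr HM]]; exists M; split => // N MN x x01 /=.
  by apply: HM => //; exists x.
Qed.

(** A nonnegative function with zero integral vanishes almost everywhere. If [f x] were nonzero,
    continuity would keep [f] nonzero on a relative neighbourhood of [x], which has positive mass
    because [x] is in the support. *)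
Lemma supp_integral_eq0 (F : cdf01 R) (f : R -> R) :
  {within `[0, 1]%classic, continuous f} ->
  (forall x, x \in `[0, 1] -> 0 <= f x) ->
  \int[dcdf F]_(x in `[0, 1]) f x = 0 ->
  forall x, supp (dcdf F) x -> f x = 0.
Proof.
move=> cf f0 if0 x Fx; have x01 := supp_dcdf01 Fx.
have m01 : measurable (`[0, 1]%classic : set T) by exact: measurable_itv.
have iF := integrable_continuous01 F cf.
have mf : measurable_fun (`[0, 1]%classic : set T) (EFin \o f).
  exact: measurable_int iF.
have [N [mN N0 fN]] : ae_eq (dcdf F) `[0%R, 1%R]%classic (EFin \o f) (cst 0%E).
  apply/(ae_eq_integral_abs _ m01 mf).
  transitivity (\int[dcdf F]_(x in `[0%R, 1%R]) (f x)%:E)%E.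
    apply: eq_integral => y; rewrite inE => y01.
    by rewrite gee0_abs// lee_fin f0.
  have := integrable_fin_num m01 iF.
  by move=> /fineK <-; congr EFin.
apply/eqP; apply/negPn/negP => fx0.
have /subspace_continuousP/(_ x x01) cfx := cf.
have : nbhs x [set y | `[0, 1]%classic y -> f y != 0].
  exact: (cvgr_neq0 (f x) cfx fx0).
rewrite nbhsE => -[U [oU Ux] Uf].
have := Fx U oU Ux; rewrite dcdf_setI01; last exact: open_measurable.
suff -> : dcdf F (U `&` `[0, 1]%classic) = 0%E by rewrite ltxx.
apply: (subset_measure0 _ _ _ N0) => //.
  by apply: measurableI => //; exact: open_measurable.
move=> y [Uy y01]; apply: fN => /= /(_ y01) [] /eqP.
by apply/negP; exact: Uf.
Qed.

End support.

(** * The conditional total payoff *)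

Section contest_lemmas.
Context {R : realType}.
Local Notation T := (measurableTypeR R).

Lemma row_tuple_perm n (s : 'S_n) (t : n.-tuple T) :
  row_tuple (perm_tuple s t) = col_perm s (row_tuple t).
Proof. by apply/rowP => i; rewrite !mxE tnth_mktuple. Qed.

Lemma cube_col_perm n (s : 'S_n) (x : 'rV[R]_n) :
  cube (col_perm s x) <-> cube x.
Proof.
split=> cx i; last by rewrite mxE; exact: cx.
by have := cx ((s^-1)%g i); rewrite mxE permKV.
Qed.

Lemma row_tuple_cons n x (t : n.-tuple T) :
  row_tuple (cons_pair (x, t)) = row_mx (x%:M : 'rV_1) (row_tuple t) :> 'rV[R]_n.+1.
Proof.
apply/rowP => i; rewrite !mxE; case: splitP => j ij.
  rewrite !mxE ord1 eqxx (_ : i = ord0)//.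
  by apply/val_inj; rewrite /= ij ord1.
rewrite mxE (_ : i = lift ord0 j) ?tnthS//.
by apply/val_inj; rewrite /= ij.
Qed.

Lemma cube_cons n x (t : n.-tuple T) :
  cube (row_tuple (cons_pair (x, t)) : 'rV[R]_n.+1) <->
  x \in `[0, 1] /\ cube (row_tuple t : 'rV[R]_n).
Proof.
split=> [cxt|[x01 ct] i].
  split; first by have := cxt ord0; rewrite mxE.
  by move=> i; have := cxt (lift ord0 i); rewrite !mxE tnthS.
by case: (unliftP ord0 i) => [j|] ->; rewrite mxE// tnthS; have := ct j; rewrite mxE.
Qed.

Lemma clamp01_id (x : R) : x \in `[0, 1] -> clamp01 x = x.
Proof.
by rewrite in_itv/= => /andP[x0 x1]; rewrite /clamp01 (min_idPr x1) (max_idPr x0).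
Qed.

Lemma clamp01_itv (x : R) : clamp01 x \in `[0, 1].
Proof. by rewrite in_itv/= clamp01_ge0 clamp01_le1. Qed.

Lemma clamp01_continuous : continuous (@clamp01 R).
Proof.
move=> x; apply: (@continuous_max R R (fun=> 0) (fun y => Num.min 1 y)).
  exact: cvg_cst.
by apply: (@continuous_min R R (fun=> 1) id) => //; exact: cvg_cst.
Qed.

Variables (n : nat) (Pi : 'rV[R]_n.+1 -> R).
Let g : n.+1.-tuple T -> R := (Pi \_ (@cube R n.+1)) \o @row_tuple R n.+1.
Hypothesis bg : bounded_meas g.

Lemma total_givenE (F : cdf01 R) x : x \in `[0, 1] ->
  total_given Pi F x = \int[prodP (fun=> dcdf F)]_t g (cons_pair (x, t)).
Proof.
move=> x01; rewrite /total_given expectE; apply: eq_Rintegral => t _.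
rewrite /g /= !patchE row_tuple_cons.
congr (if _ then _ else _); apply/idP/idP; rewrite !inE -row_tuple_cons.
  by move=> ct; apply/cube_cons.
by move=> /cube_cons[].
Qed.

(** Outside [0,1] the first coordinate leaves the cube, where [g] is 0. Integrals over the line thus
    reduce to integrals over [0,1]. *)
Lemma total_given_out (F : cdf01 R) x : x \notin `[0, 1] ->
  \int[prodP (fun=> dcdf F)]_t g (cons_pair (x, t)) = 0.
Proof.
move=> x01; rewrite (@eq_Rintegral _ _ _ _ _ (fun=> 0)).
  by rewrite Rintegral_cst// mul0r.
move=> t _; rewrite /g /= patchE ifF//; apply/negbTE/negP.
by rewrite inE => /cube_cons[]; rewrite (negbTE x01).
Qed.

(** Continuity passes under the integral by domination with the constant bound of [g]. *)
Lemma total_given_continuous (F : cdf01 R) :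
  {within @cube R n.+1, continuous Pi} ->
  {within `[0, 1]%classic, continuous (total_given Pi F)}.
Proof.
move=> /subspace_continuousP cPi.
(* The zero extension [g] may jump where [x] leaves [0,1]. Clamping [x] gives a function continuous
   on the whole line that is unchanged on [0,1]. *)
pose h x t := g (cons_pair (clamp01 x, t)).
have bh x : bounded_meas (h x).
  exact: (bounded_meas_section1 (bounded_meas_cons_pair bg)).
have [_ [M gM]] := bg.
have ch t : continuous (h ^~ t).
  move=> a; rewrite /h /g /=.
  have [ct|nct] := pselect (cube (row_tuple t)); last first.
    rewrite (_ : (fun x => _) = fun=> 0); first exact: cvg_cst.
    apply/funext => x; rewrite patchE ifF//; apply/negbTE/negP.
    by rewrite inE => /cube_cons[].
  have cx x : cube (row_tuple (cons_pair (clamp01 x, t))).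
    by apply/cube_cons; split => //; exact: clamp01_itv.
  rewrite /continuous_at.
  under eq_fun do rewrite patchE (mem_set (cx _)).
  rewrite patchE (mem_set (cx _)).
  apply: (cvg_comp _ Pi _ (cPi _ (cx a))).
  move=> A /= /nbhs_ballP[e /= e0 eA].
  have : \forall x \near a, ball (clamp01 a) e (clamp01 x).
    by apply: clamp01_continuous; exact: nbhsx_ballx.
  apply: filterS => x ax; apply: eA => //; split => // i j.
  rewrite !mxE; case: (unliftP ord0 j) => [k|] ->.
    by rewrite !tnthS; exact: ballxx.
  exact: ax.
have /= cI := @continuity_under_integral R _ _ (prodP (fun=> dcdf F)) h setT
  (* An open interval around [0,1], so that the endpoints are interior points. *)
  measurableT (-1) 2 (fun x _ => bounded_meas_integrable _ (bh x)) _ (fun=> M) _ _.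
apply: (@subspace_eq_continuous _ _ _ (fun x => \int[prodP (fun=> dcdf F)]_t h x t)).
  move=> x; rewrite inE => x01.
  rewrite [RHS](total_givenE F x01).
  by apply: eq_Rintegral => t _; rewrite /h clamp01_id.
apply: continuous_in_subspaceT => x; rewrite inE/= in_itv/= => /andP[x0 x1].
apply: cI.
- by apply: aeW => t _ y _; exact: ch.
- exact/bounded_meas_integrable/bounded_meas_cst.
- by move=> y _; apply: aeW => t _; exact: gM.
- by rewrite inE/= in_itv/=; apply/andP; split; [lra|lra].
Qed.

End contest_lemmas.

(** * First-order variation of the revenue *)

Section first_order_condition.
Context {R : realType}.
Local Notation T := (measurableTypeR R).
Variables (n : nat) (pibar : R).
Variables (pay : 'I_n.+1 -> 'rV[R]_n.+1 -> R) (Pi : 'rV[R]_n.+1 -> R).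
Hypothesis hpay : gross_payoffs pibar pay Pi.

Let payT i : n.+1.-tuple T -> R :=
  (pay i \_ (@cube R n.+1)) \o @row_tuple R n.+1.
Let totT : n.+1.-tuple T -> R := (Pi \_ (@cube R n.+1)) \o @row_tuple R n.+1.

Lemma bounded_meas_pay i : bounded_meas (payT i).
Proof.
apply: (@bounded_meas_cube _ _ _ pibar); first exact: pay_borel hpay i.
by move=> x cx; have /andP[p0 p1] := pay_bounded hpay i cx; rewrite ger0_norm.
Qed.

Lemma total_sum_pay t : totT t = \sum_(i < n.+1) payT i t.
Proof.
rewrite /totT /payT /= patchE; case: ifPn => ct.
  rewrite -(total_sum hpay); last by rewrite inE in ct.
  by apply: eq_bigr => i _; rewrite patchE ct.
by rewrite big1// => i _; rewrite patchE (negbTE ct).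
Qed.

Lemma bounded_meas_total : bounded_meas totT.
Proof.
have -> : totT = fun t => \sum_(i < n.+1) payT i t.
  by apply/funext => t; exact: total_sum_pay.
by apply: bounded_meas_sum => i; exact: bounded_meas_pay.
Qed.

(** The cube is invariant under permutations, so the symmetry of the payoffs survives the extension
    by 0. *)
Lemma pay_perm s i t : payT i (perm_tuple s t) = payT (s i) t.
Proof.
rewrite /payT /= row_tuple_perm !patchE.
have -> : (col_perm s (row_tuple t) \in @cube R n.+1) =
    (row_tuple t \in @cube R n.+1).
  by apply/idP/idP; rewrite !inE => /cube_col_perm.
by case: ifPn => //; rewrite inE => ct; rewrite (pay_symmetric hpay).
Qed.

(* Player 0's payoff with the deviation in coordinate i is player i's payoff
   with the deviation in coordinate 0, by the transposition (0 i). *)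
Lemma sum_pay_deviation (P Q : probability T R) :
  \sum_(i < n.+1)
    \int[prodP (fun j => if j == i then Q else P)]_t payT ord0 t =
  \int[prodP (fun j => if j == ord0 then Q else P)]_t totT t.
Proof.
under [RHS]eq_Rintegral do rewrite total_sum_pay.
rewrite Rintegral_sum_bounded; last exact: bounded_meas_pay.
apply: eq_bigr => i _; set D := fun j => if j == ord0 then Q else P.
have -> : (fun j => if j == i then Q else P) = D \o tperm ord0 i.
  apply/funext => j; rewrite /D /=; congr (if _ then _ else _).
  by rewrite -(inj_eq (@perm_inj _ (tperm ord0 i)) j) tpermR.
rewrite Rintegral_prodP_perm; last exact: bounded_meas_pay.
by apply: eq_Rintegral => t _; rewrite pay_perm tpermL.
Qed.

(** Conditioning on the deviating coordinate 0: the others remain i.i.d. with law [dcdf F], and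
    values outside [0,1] contribute 0. *)
Lemma total_given_Rintegral (F H : cdf01 R) :
  \int[prodP (fun j : 'I_n.+1 => if j == ord0 then dcdf H else dcdf F)]_t totT t
  = \int[dcdf H]_(x in `[0, 1]) total_given Pi F x.
Proof.
have bT := bounded_meas_total.
rewrite [LHS](Rintegral_prodP1 _ bT) -[LHS]/(\int[dcdf H]_x
  \int[prodP (fun=> dcdf F)]_t totT (cons_pair (x, t))).
rewrite [RHS]Rintegral_mkcond; apply: eq_Rintegral => x _.
rewrite patchE; case: ifPn => x01.
  by rewrite [RHS]total_givenE//; move: x01; rewrite inE.
by apply: total_given_out; apply: contra x01; rewrite inE.
Qed.

Lemma planner_revenue_slope (G H : cdf01 R) :
  e^-1 * (expect (fun=> mix e G H) (pay ord0) - expect (fun=> G) (pay ord0))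
    @[e --> (0 : R)^'+] -->
  \int[dcdf H]_(x in `[0, 1]) total_given Pi G x -
  \int[dcdf G]_(x in `[0, 1]) total_given Pi G x.
Proof.
have bp := bounded_meas_pay ord0.
have [p [p0 p1 pE]] := prodP_mixture_poly
  (fun e h e01 bh => Rintegral_mix G H e01 bh) bp.
have {}p1 : p`_1 = \int[dcdf H]_(x in `[0, 1]) total_given Pi G x -
    \int[dcdf G]_(x in `[0, 1]) total_given Pi G x.
  rewrite p1 sumrB -(total_given_Rintegral G H) -(total_given_Rintegral G G).
  congr (_ - _); first exact: sum_pay_deviation.
  (* The subtracted baseline is the case without deviation, [Q = P], of the same identity. *)
  rewrite -[RHS](sum_pay_deviation (dcdf G) (dcdf G)).
  apply: eq_bigr => i _; congr (\int[prodP _]_t _).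
  by apply/funext => j; rewrite if_same.
rewrite -p1.
have pD e : p.[e] = p`_0 + e * (drop_poly 1 p).[e].
  rewrite -{1}(poly_take_drop 1 p) hornerD hornerM hornerXn expr1 mulrC.
  rewrite (_ : take_poly 1 p = (p`_0)%:P) ?hornerC//.
  by apply/polyP => -[|i]; rewrite coef_take_poly coefC.
have -> : p`_1 = (drop_poly 1 p).[0] by rewrite horner_coef0 coef_drop_poly.
have c0 : (drop_poly 1 p).[e] @[e --> (0 : R)^'+] --> (drop_poly 1 p).[0].
  by apply: cvg_at_right_filter; exact: continuous_horner.
apply: cvg_trans c0; apply: near_eq_cvg; near=> e.
have e0 : 0 < e by near: e; exact: nbhs_right_gt.
have e1 : e <= 1 by near: e; exact: nbhs_right_le.
rewrite !expectE -[X in X - _]pE ?e1 ?ltW// -[X in _ - X]p0.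
by rewrite pD addrC addKr mulKf// gt_eqF.
Unshelve. all: by end_near. Qed.

End first_order_condition.

(** * Optimality conditions for the planner *)

(* The number of players is n.+2. *)
Theorem proposition3p8 (R : realType) (n : nat) (pibar : R)
    (pay : 'I_n.+2 -> 'rV[R]_n.+2 -> R) (Pi : 'rV[R]_n.+2 -> R)
    (C : cdf01 R -> R) (c : cdf01 R -> R -> R)
    (hpay : gross_payoffs pibar pay Pi) (hC : cost_functional pibar C c)
    (G : cdf01 R)
    (hG : forall F : cdf01 R, planner pay C F <= planner pay C G) :
  exists lambda : R,
    (forall x : R, x \in `[0, 1] -> total_given Pi G x - c G x <= lambda) /\
    (forall x : R, supp (dcdf G) x -> total_given Pi G x - c G x = lambda).
Proof.
pose A := total_given Pi G.
have bT := bounded_meas_total hpay.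
have cA : {within `[0, 1]%classic, continuous A}.
  exact: (total_given_continuous bT (total_continuous hpay)).
have cc : {within `[0, 1]%classic, continuous (c G)}.
  exact: (cost_grad_continuous hC).
have m01 : measurable (`[0, 1]%classic : set (measurableTypeR R)).
  exact: measurable_itv.
have iA := integrable_continuous01 G cA.
have ic := integrable_continuous01 G cc.
exists (\int[dcdf G]_(x in `[0, 1]) A x - \int[dcdf G]_(x in `[0, 1]) c G x).
set lambda := _ - _.
(* Used twice: to turn optimality into a bound of the revenue increment by the cost increment, and
   to regroup the limiting inequality into the bound by [lambda]. *)
have swap (r s t u : R) : r - s <= t - u -> r - t <= s - u by lra.
have le_lambda x : x \in `[0, 1] -> A x - c G x <= lambda.
  move=> x01; have /andP[x0 x1] : (0 <= x) && (x <= 1) by move: x01; rewrite in_itv.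
  have Dx : `[0, 1]%classic x by [].
  pose H := point_cdf x0 x1.
  have := @planner_revenue_slope _ _ _ _ _ hpay G H.
  rewrite (Rintegral_point_cdf x0 x1 m01 Dx); last first.
    exact: subspace_continuous_measurable_fun cA.
  have := @cost_gateaux _ _ _ _ hC G H.
  rewrite (Rintegral_point_cdf x0 x1 m01 Dx); last first.
    exact: subspace_continuous_measurable_fun cc.
  move=> cost_slope revenue_slope.
  have /= le_slope := ler_cvg_to revenue_slope cost_slope.
  suff : A x - \int[dcdf G]_(x in `[0, 1]) A x
      <= c G x - \int[dcdf G]_(x in `[0, 1]) c G x.
    by move/swap.
  apply: le_slope; near=> e.
  have e0 : 0 < e by near: e; exact: nbhs_right_gt.
  rewrite ler_pM2l ?invr_gt0//.
  exact: swap (hG (mix e G H)).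
split=> // x Gx.
(* The slack in the inequality. Its integral is 0 because dG has mass 1 on [0,1] and [lambda] is the
   integral of [A - c G]. *)
pose f (y : R) : R := lambda - (A y - c G y).
have cAc : {within `[0, 1]%classic, continuous (fun y : R => A y - c G y)}.
  exact: (within_continuousB cA cc).
have clambda : {within `[0, 1]%classic, continuous (fun _ : R => lambda : R)}.
  by apply: continuous_subspaceT => y; exact: cvg_cst.
have cf : {within `[0, 1]%classic, continuous f}.
  exact: (within_continuousB clambda cAc).
apply/eqP; rewrite eq_sym -subr_eq0; apply/eqP.
apply: (supp_integral_eq0 cf _ _ Gx) => [y y01|].
  by rewrite subr_ge0 le_lambda.
rewrite (RintegralB m01 (integrable_continuous01 G clambda)
  (integrable_continuous01 G cAc)) (RintegralB m01 iA ic) -/lambda.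
by rewrite Rintegral_cst// [X in fine X]dcdf01 mulr1 subrr.
Unshelve. all: by end_near. Qed.
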